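(* Let $R$ be a commutative $\mathbb{Q}$-algebra and let $\varphi\colon \varOmega^U_*\to R$ be a complex genus with exponent $f(x)=x+\ldots\in R[[x]]$. Suppose that (i) $\varphi$ is $T^2$-rigid on the sphere $S^6=G_2/SU(3)$ equipped with its $T^2$-invariant almost complex structure (where $T^2\subset G_2$ is the maximal torus), (ii) $\varphi([S^6])=0$, and (iii) $\varphi$ is $T^5$-rigid on the $10$-dimensional omnioriented quasitoric manifold $\widetilde L(2,3)$ described in the context. Then there exist $\alpha,\delta,\varepsilon\in R$ such that $f(x)=e^{\alpha x}\,\mathrm{sn}(x)$, where $\mathrm{sn}(x)=x+\ldots\in R[[x]]$ is the unique power series satisfying $(\mathrm{sn}'(x))^2=1-2\delta\,\mathrm{sn}^2(x)+\varepsilon\,\mathrm{sn}^4(x)$; that is, $\varphi$ is the Krichever genus with parameter $b_2=0$.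
   Context: A complex genus is a ring homomorphism $\varphi\colon\varOmega^U_*\to R$ from the complex bordism ring. For $R$ a $\mathbb{Q}$-algebra, complex genera correspond bijectively to power series $f(x)=x+\ldots\in R[[x]]$ (the exponent): $\varphi([M])=\langle P_f(TM),[M]\rangle$ where $P_f$ is the multiplicative characteristic class obtained from $\prod_i x_i/f(x_i)$ in terms of Chern roots. Every genus has a universal $T^k$-equivariant extension $\varphi^T\colon\varOmega^{U:T^k}_*\to R[[x_1,\dots,x_k]]$ on bordism of stably complex manifolds with $T^k$-action and invariant stably complex structure, whose constant term is $\varphi([M])$; $\varphi$ is $T^k$-rigid on $M$ if $\varphi^T([M])$ equals its constant term $\varphi([M])$. When the fixed points of $M^{2n}$ are isolated, $\varphi^T([M])=\sum_{p\in M^T}\sigma(p)\prod_{i=1}^n 1/f(\langle w_i(p),x\rangle)$, where $w_1(p),\dots,w_n(p)\in\mathbb{Z}^k$ are the weights of the tangent representation at $p$, $\sigma(p)=\pm1$ is the sign comparing the orientation of $T_pM$ induced by the stably complex structure with that from the complex representation, and $\langle w,x\rangle=\sum_j w_jx_j$. Quasitoric manifold: given a simple $n$-polytope $P\subset\mathbb{R}^n$ with facets $F_1,\dots,F_m$ (inward normals $a_j$) and an integer $n\times m$ matrix $\Lambda$ such that for every vertex $v=F_{j_1}\cap\dots\cap F_{j_n}$ the submatrix $\Lambda_v$ of columns $j_1,\dots,j_n$ has determinant $\pm1$, there is an omnioriented quasitoric $2n$-manifold $M(P,\Lambda)$ with a $T^n$-action and invariant stably complex structure; its fixed points correspond to vertices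 $v$, with weights the rows of $\Lambda_v^{-1}$ and sign $\mathrm{sign}(\det\Lambda_v\cdot\det(a_{j_1},\dots,a_{j_n}))$. $\widetilde L(2,3)=M(P,\Lambda)$ where $P=\Delta^2\times\Delta^3\subset\mathbb{R}^5$ is given by $x_1\ge0,x_2\ge0,x_1+x_2\le1,x_3\ge0,x_4\ge0,x_5\ge0,x_3+x_4+x_5\le1$, with facets ordered so that the inward normals are $a_1=e_1,a_2=e_2,a_3=-e_1-e_2,a_4=e_3,a_5=e_4,a_6=e_5,a_7=-e_3-e_4-e_5$, and $\Lambda=\begin{pmatrix}1&0&1&0&0&0&0\\0&1&-1&0&0&0&0\\0&0&1&1&0&0&1\\0&0&0&0&1&0&-1\\0&0&0&0&0&1&1\end{pmatrix}$. It is an $SU$-manifold (first Chern class zero). *)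

(* Defs.v *)
From HB Require Import structures.
From mathcomp Require Import all_boot all_order all_algebra.
From mathcomp Require Import mpoly.
Set Implicit Arguments. Unset Strict Implicit. Unset Printing Implicit Defensive.
Import Order.TTheory GRing.Theory Num.Theory.
Local Open Scope ring_scope.

Section Univariate.
Variable R : comAlgType rat.

Definition pser := nat -> R.
Definition pconst (c : R) : pser := fun n => if n == 0%N then c else 0.
Definition pmul (a b : pser) : pser :=
  fun n => \sum_(i < n.+1) a i * b (n - i)%N.
Definition pderiv (a : pser) : pser := fun n => a n.+1 *+ n.+1.
Definition pexp (alpha : R) : pser := fun n => ((n`!%:R)^-1 : rat) *: alpha ^+ n.
End Univariate.

Definition is_sn (R : comAlgType rat) (delta eps : R) (s : pser R) : Prop :=
  [/\ s 0%N = 0, s 1%N = 1 &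
      forall n, pmul (pderiv s) (pderiv s) n =
        pconst 1 n - (2%:R * delta) * pmul s s n
        + eps * pmul (pmul s s) (pmul s s) n].

(* Multivariate power series R[[x_1..x_k]] : coefficient functions on       *)
(* monomials; identities are tested on all truncations to degree <= N,      *)
(* computed in the polynomial ring {mpoly R[k]}.                            *)
Section Multivariate.
Variables (R : comAlgType rat) (k : nat).

Definition mpser := 'X_{1..k} -> R.
Definition mpconst (c : R) : mpser := fun m => if m == 0%MM then c else 0.

Definition mtrunc (N : nat) (p : {mpoly R[k]}) : {mpoly R[k]} :=
  \sum_(m <- msupp p | (mdeg m <= N)%N) p@_m *: 'X_[m].

Definition strunc (N : nat) (G : mpser) : {mpoly R[k]} :=
  \sum_(m : 'X_{1..k < N.+1}) G (bmnm m) *: 'X_[bmnm m].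

Definition linform (w : 'rV[rat]_k) : {mpoly R[k]} :=
  \sum_(j < k) (w 0 j)%:A *: 'X_j.

Definition comp_lin (f : pser R) (w : 'rV[rat]_k) (N : nat) : {mpoly R[k]} :=
  \sum_(n < N.+1) f n *: linform w ^+ n.

(* Fixed point data of a T^k-action with isolated fixed points: for each   *)
(* fixed point p, its sign sigma(p) = +-1 and its list of tangent weights.  *)
Definition fixdata := seq (rat * seq 'rV[rat]_k).

(* "phi^T([M]) = G" where phi^T([M]) = sum_p sigma(p) prod_i 1/f(<w_i(p),x>) *)
(* (localization formula), with denominators cleared: multiplying by the   *)
(* non-zero-divisor F = prod_p prod_i f(<w_i(p),x>) gives                   *)
(*   sum_p sigma(p) prod_{q <> p} prod_i f(<w_i(q),x>) = G * F              *)
(* as power series, i.e. in every degree-<=N truncation.                    *)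
Definition equiv_genus_is (f : pser R) (M : fixdata) (G : mpser) : Prop :=
  forall N : nat,
    mtrunc N (\sum_(p < size M)
                (nth (0, [::]) M p).1%:A *:
                \prod_(q < size M | q != p)
                   \prod_(w <- (nth (0, [::]) M q).2) comp_lin f w N)
    = mtrunc N (strunc N G *
                \prod_(p <- M) \prod_(w <- p.2) comp_lin f w N).

Definition rigid (f : pser R) (M : fixdata) : Prop :=
  exists c : R, equiv_genus_is f M (mpconst c).

Definition genus_value_is (f : pser R) (M : fixdata) (c : R) : Prop :=
  forall G : mpser, equiv_genus_is f M G -> G 0%MM = c.

End Multivariate.

(* S^6 = G_2/SU(3) with the T^2-action of the maximal torus T^2 of SU(3),   *)
(* invariant almost complex structure: two fixed points, signs +1, tangent  *)
(* weights e1, e2, -e1-e2 (standard rep. of SU(3)) and their negatives.     *)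
Definition e2_1 : 'rV[rat]_2 := \row_(j < 2) (if j == 0 :> nat then 1 else 0).
Definition e2_2 : 'rV[rat]_2 := \row_(j < 2) (if j == 1 :> nat then 1 else 0).
Definition S6_fixdata : fixdata 2 :=
  [:: (1, [:: e2_1; e2_2; - e2_1 - e2_2]);
      (1, [:: - e2_1; - e2_2; e2_1 + e2_2])].

(* Quasitoric manifolds M(P, Lambda): P = {x | a_j . x + b_j >= 0} simple,  *)
(* facets 'I_m.+1, A has rows a_j.  A vertex is a set S of n facets with    *)
(* independent normals whose common point lies in P.  Columns of Lambda_v   *)
(* and rows of A_v are taken in increasing facet order.                     *)
Section Quasitoric.
Variables (n m : nat) (A : 'M[rat]_(m.+1, n)) (b : 'cV[rat]_m.+1)
          (Lam : 'M[int]_(n, m.+1)).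

Definition facet_of (S : {set 'I_m.+1}) (j : 'I_n) : 'I_m.+1 :=
  nth ord0 (enum S) j.
Definition A_v (S : {set 'I_m.+1}) : 'M[rat]_n :=
  \matrix_(i < n, j < n) A (facet_of S i) j.
Definition b_v (S : {set 'I_m.+1}) : 'cV[rat]_n :=
  \col_(i < n) b (facet_of S i) 0.
Definition Lam_v (S : {set 'I_m.+1}) : 'M[rat]_n :=
  \matrix_(i < n, j < n) (Lam i (facet_of S j))%:~R.
Definition vertex_point (S : {set 'I_m.+1}) : 'cV[rat]_n :=
  - (invmx (A_v S) *m b_v S).
Definition is_vertex (S : {set 'I_m.+1}) : bool :=
  [&& #|S| == n, A_v S \in unitmx &
      [forall j, 0 <= (A *m vertex_point S + b) j 0]].
Definition qt_sign (S : {set 'I_m.+1}) : rat :=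
  Num.sg (\det (Lam_v S) * \det (A_v S)).
Definition qt_weights (S : {set 'I_m.+1}) : seq 'rV[rat]_n :=
  [seq row i (invmx (Lam_v S)) | i <- enum 'I_n].
Definition qt_fixdata : fixdata n :=
  [seq (qt_sign V, qt_weights V) | V <- enum [set V : {set 'I_m.+1} | is_vertex V]].
End Quasitoric.

(* L~(2,3): P = Delta^2 x Delta^3 in R^5, facets with inward normals        *)
(* a1=e1, a2=e2, a3=-e1-e2, a4=e3, a5=e4, a6=e5, a7=-e3-e4-e5.              *)
Definition L23_A : 'M[rat]_(7, 5) :=
  \matrix_(j < 7, i < 5)
   (nth 0 (nth [::] [:: [:: 1; 0; 0; 0; 0];
                        [:: 0; 1; 0; 0; 0];
                        [:: -1; -1; 0; 0; 0];
                        [:: 0; 0; 1; 0; 0];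
                        [:: 0; 0; 0; 1; 0];
                        [:: 0; 0; 0; 0; 1];
                        [:: 0; 0; -1; -1; -1]] j) i : rat).
Definition L23_b : 'cV[rat]_7 :=
  \col_(j < 7) (nth 0 [:: 0; 0; 1; 0; 0; 0; 1] j : rat).
Definition L23_Lam : 'M[int]_(5, 7) :=
  \matrix_(i < 5, j < 7)
   (nth 0 (nth [::] [:: [:: 1; 0; 1; 0; 0; 0; 0];
                        [:: 0; 1; -1; 0; 0; 0; 0];
                        [:: 0; 0; 1; 1; 0; 0; 1];
                        [:: 0; 0; 0; 0; 1; 0; -1];
                        [:: 0; 0; 0; 0; 0; 1; 1]] i) j : int).
Definition L23_fixdata : fixdata 5 := qt_fixdata L23_A L23_b L23_Lam.

(* Main.v *)
Require Import Defs.
From HB Require Import structures.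
From mathcomp Require Import all_boot all_order all_algebra.
From mathcomp Require Import mpoly.
From mathcomp Require Import boolp ring zify.
Set Implicit Arguments. Unset Strict Implicit. Unset Printing Implicit Defensive.
Import Order.TTheory GRing.Theory Num.Theory.
Local Open Scope ring_scope.

(** Substituting x_j := c_j X turns every localization identity into an identity in
    A[[X]], in which f(cX) is not a zero divisor as soon as c is regular in A.

    At x = (1, 1) the vanishing of the equivariant genus of S^6 reads
    f(-x)^2 f(2x) + f(x)^2 f(-2x) = 0; comparing lowest coefficients, this forces
    f = e^(alpha x) s with s odd.

    L~(2,3) fibres over CP^2 with fibre CP^3.  Its weights have the same sum at all
    vertices, so f may be replaced by s, and rigidity says that
    s(u+v) Phi(z) - s(u) Phi(z+v) - s(v) Phi(z-u) = 0, up to a constant that turns out to be 0,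
    where Phi(z) = Phi(z; a, b) = sum_i prod_(j <> i) 1/s(t_i - t_j), t = (0, z, -a, b), is the
    genus of the fibre.  Phi vanishes by oddness whenever the t_i are symmetric about a point.
    Choosing u, v such that this applies to both z+v and z-u leaves Phi(z) = 0.  For a = 1,
    b = -z this is
    s(z) s(1) (s(1-z) + s(1+z)) = s(2z) (s(1+z) s(1-z) + s(z)^2),
    and the coefficient of z^3 is the equation s s'' = 2 s'^2 - 2 - 6 s_3 s^2, which integrates
    to s'^2 = 1 + 6 s_3 s^2 + eps s^4. *)

(** * Formal power series *)

(** Convertible to [pser] on [R]; the separate name carries the ring structure over any coefficient
    ring, with extensional equality. *)
Definition pws (A : Type) := nat -> A.
HB.instance Definition _ (A : Type) := gen_eqMixin (pws A).
HB.instance Definition _ (A : Type) := gen_choiceMixin (pws A).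

Section PwsRing.
Variable A : comNzRingType.
Implicit Types p q r : pws A.

Definition pws_opp p : pws A := fun n => - p n.
Definition pws_add p q : pws A := fun n => p n + q n.
Definition pws_mul p q : pws A := fun n => \sum_(i < n.+1) p i * q (n - i)%N.
Definition pws_one : pws A := fun n => if n == 0%N then 1 else 0.

Lemma pws_addA : associative pws_add.
Proof. by move=> p q r; apply: funext => n; apply: addrA. Qed.
Lemma pws_addC : commutative pws_add.
Proof. by move=> p q; apply: funext => n; apply: addrC. Qed.
Lemma pws_add0 : left_id (fun=> 0) pws_add.
Proof. by move=> p; apply: funext => n; apply: add0r. Qed.
Lemma pws_addN : left_inverse (fun=> 0) pws_opp pws_add.
Proof. by move=> p; apply: funext => n; apply: addNr. Qed.

HB.instance Definition _ :=
  GRing.isZmodule.Build (pws A) pws_addA pws_addC pws_add0 pws_addN.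

Definition ptrunc n p : {poly A} := \poly_(i < n.+1) p i.

(** Truncation reduces the ring axioms to those of polynomials; the free bound [m] lets a single
    truncation degree serve all coefficients of an iterated product. *)
Lemma pws_mulE n m p q : (n <= m)%N ->
  pws_mul p q n = (ptrunc m p * ptrunc m q)`_n.
Proof.
move=> le_nm; rewrite coefM; apply: eq_bigr => -[i /= lt_in] _.
by rewrite !coef_poly !ltnS (leq_trans (leq_subr _ _)) // (leq_trans _ le_nm).
Qed.

Lemma pws_mulC : commutative pws_mul.
Proof. by move=> p q; apply: funext => n; rewrite !(pws_mulE _ _ (leqnn n)) mulrC. Qed.

Lemma pws_mulA : associative pws_mul.
Proof.
move=> p q r; apply: funext => n.
transitivity ((ptrunc n p * ptrunc n q * ptrunc n r)`_n).
  rewrite -mulrA coefM; apply: eq_bigr => -[i /= lt_in] _.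
  by rewrite coef_poly lt_in (pws_mulE _ _ (leq_subr i n)).
rewrite coefM; apply: eq_bigr => -[i /= lt_in] _.
by rewrite -pws_mulE // coef_poly ltnS leq_subr.
Qed.

Lemma pws_mul1 : left_id pws_one pws_mul.
Proof.
move=> p; apply: funext => n; rewrite /pws_mul big_ord_recl mul1r subn0 big1 ?addr0 //.
by move=> i _; rewrite mul0r.
Qed.

Lemma pws_mulDl : left_distributive pws_mul pws_add.
Proof.
move=> p q r; apply: funext => n; rewrite /pws_mul /pws_add -big_split.
by apply: eq_bigr => i _; apply: mulrDl.
Qed.

Lemma pws_oner_neq0 : pws_one != 0.
Proof. by apply/eqP => /(congr1 (@^~ 0%N)) /= /eqP; apply/negP/oner_neq0. Qed.

HB.instance Definition _ := GRing.Zmodule_isComNzRing.Build (pws A)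
  pws_mulA pws_mulC pws_mul1 pws_mulDl pws_oner_neq0.

Lemma pws1E n : (1 : pws A) n = (n == 0%N)%:R. Proof. by case: n. Qed.
Lemma pwsDE p q n : (p + q) n = p n + q n. Proof. by []. Qed.
Lemma pwsNE p n : (- p) n = - p n. Proof. by []. Qed.
Lemma pwsME p q n : (p * q) n = \sum_(i < n.+1) p i * q (n - i)%N. Proof. by []. Qed.
Lemma pwsM0 p q : (p * q) 0%N = p 0%N * q 0%N.
Proof. by rewrite pwsME big_ord1. Qed.
Lemma pwsMnE p k n : (p *+ k) n = p n *+ k.
Proof. by elim: k => [|k IH]; rewrite ?mulr0n // !mulrS pwsDE IH. Qed.

Lemma pwsM_low p q m n :
  (forall i, (i < m)%N -> p i = 0) -> (forall i, (i < n)%N -> q i = 0) ->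
  (p * q) (m + n)%N = p m * q n.
Proof.
move=> p0 q0; have lt_m : (m < (m + n).+1)%N by rewrite ltnS leq_addr.
rewrite pwsME (bigD1 (Ordinal lt_m)) //= addKn big1 ?addr0 // => i.
rewrite -val_eqE /= neq_ltn => /orP[lt_im | lt_mi]; first by rewrite p0 ?mul0r.
by rewrite q0 ?mulr0 //; have := ltn_ord i; lia.
Qed.

Lemma pwsM_vanish p q m n i :
  (forall i, (i < m)%N -> p i = 0) -> (forall i, (i < n)%N -> q i = 0) ->
  (i < m + n)%N -> (p * q) i = 0.
Proof.
move=> p0 q0 lt_i; rewrite pwsME big1 // => -[j /= lt_ji] _.
have [lt_jm|le_mj] := ltnP j m; first by rewrite p0 ?mul0r.
by rewrite q0 ?mulr0 //; lia.
Qed.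

(** Zero divisors are allowed in [A], so regularity of the lowest coefficient replaces its being
    nonzero. If p q = 0, each coefficient of q in turn is killed by [p m]. *)
Lemma pws_lreg_low p m :
  (forall i, (i < m)%N -> p i = 0) -> GRing.lreg (p m) -> GRing.lreg p.
Proof.
move=> p0 regp; apply: mulrI0_lreg => q pq0; apply: funext.
elim/ltn_ind => n IH; apply: regp; rewrite mulr0.
by rewrite -(pwsM_low p0 IH) pq0.
Qed.

Lemma pws_lreg0 p : p 0%N = 1 -> GRing.lreg p.
Proof. by move=> p1; apply: (@pws_lreg_low _ 0) => //; rewrite p1; apply: lreg1. Qed.

Definition pwsC (c : A) : pws A := fun n => if n == 0%N then c else 0.

Lemma pwsCME c p n : (pwsC c * p) n = c * p n.
Proof.
by rewrite pwsME big_ord_recl subn0 big1 ?addr0 // => i _; apply: mul0r.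
Qed.

Lemma pwsC_is_zmod_morphism : zmod_morphism pwsC.
Proof.
by move=> c d; apply: funext => -[|n]; rewrite pwsDE pwsNE /pwsC //= subr0.
Qed.
Lemma pwsC_is_monoid_morphism : monoid_morphism pwsC.
Proof.
split=> [//|c d]; apply: funext => n; rewrite pwsCME /pwsC.
by case: ifP; rewrite ?mulr0.
Qed.
HB.instance Definition _ :=
  GRing.isZmodMorphism.Build A (pws A) pwsC pwsC_is_zmod_morphism.
HB.instance Definition _ :=
  GRing.isMonoidMorphism.Build A (pws A) pwsC pwsC_is_monoid_morphism.

(* [pscale c p] is the series p(cX). *)
Definition pscale (c : A) p : pws A := fun n => p n * c ^+ n.

Lemma pscale_is_zmod_morphism c : zmod_morphism (pscale c).
Proof. by move=> p q; apply: funext => n; apply: mulrBl. Qed.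
Lemma pscale_is_monoid_morphism c : monoid_morphism (pscale c).
Proof.
split=> [|p q]; apply: funext => n.
  by rewrite /pscale pws1E; case: n => [|n]; rewrite ?expr0 ?mulr1 ?mul0r.
rewrite /pscale !pwsME mulr_suml; apply: eq_bigr => -[i /= lt_in] _.
by rewrite mulrACA -exprD subnKC.
Qed.
HB.instance Definition _ c :=
  GRing.isZmodMorphism.Build (pws A) (pws A) (pscale c) (pscale_is_zmod_morphism c).
HB.instance Definition _ c :=
  GRing.isMonoidMorphism.Build (pws A) (pws A) (pscale c) (pscale_is_monoid_morphism c).

Lemma pscale1 p : pscale 1 p = p.
Proof. by apply: funext => n; rewrite /pscale expr1n mulr1. Qed.

Lemma pscale_pscale c d p : pscale c (pscale d p) = pscale (d * c) p.
Proof. by apply: funext => n; rewrite /pscale exprMn mulrA. Qed.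

(** The binomial theorem. The hypothesis expresses e_n = a^n / n! without division, so it also makes
    sense over [{poly R}]. *)
Lemma pscale_exp (e : pws A) c d :
  (forall i j, e i * e j = e (i + j)%N *+ 'C(i + j, i)) ->
  pscale c e * pscale d e = pscale (c + d) e.
Proof.
move=> eM; apply: funext => n; rewrite pwsME /pscale addrC exprDn mulr_sumr.
apply: eq_bigr => -[i /= lt_in] _.
by rewrite mulrACA eM subnKC // mulrnAl mulrnAr [d ^+ _ * _]mulrC.
Qed.
End PwsRing.

(** * Coefficients with respect to a polynomial parameter *)

Section Poly.
Variable A : comNzRingType.
(* Here 'X is a parameter, not the variable of the power series. *)
Definition pcoef k (p : pws {poly A}) : pws A := fun n => (p n)`_k.

Lemma pcoefD k p q : pcoef k (p + q) = pcoef k p + pcoef k q.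
Proof. by apply: funext => n; apply: coefD. Qed.
Lemma pcoefM k p q :
  pcoef k (p * q) = \sum_(i < k.+1) pcoef i p * pcoef (k - i) q.
Proof.
apply: funext => n.
have -> : (\sum_(i < k.+1) pcoef i p * pcoef (k - i) q) n
    = \sum_(i < k.+1) (pcoef i p * pcoef (k - i) q) n.
  by elim/big_ind2: _ => // x y u v <- <-.
rewrite /pcoef pwsME coef_sum exchange_big /=.
by under eq_bigr do rewrite coefM.
Qed.
End Poly.

(** * Localization along a line *)

Section PX.
Variable A : comNzRingType.
Definition pwsX : pws A := fun n => (n == 1%N)%:R.

Lemma pwsXM0 (p : pws A) : (pwsX * p) 0%N = 0.
Proof. by rewrite pwsM0 mul0r. Qed.
Lemma pwsXMS (p : pws A) n : (pwsX * p) n.+1 = p n.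
Proof.
rewrite pwsME big_ord_recl mul0r add0r big_ord_recl subSS subn0 mul1r big1 ?addr0 //.
by move=> i _; apply: mul0r.
Qed.
Lemma pwsXnE k n : (pwsX ^+ k) n = (n == k)%:R.
Proof.
elim: k n => [|k IH] n; first by rewrite expr0 pws1E.
by rewrite exprS; case: n => [|n]; rewrite ?pwsXM0 // pwsXMS IH.
Qed.
Lemma pwsX_lreg : GRing.lreg pwsX.
Proof. by apply: (@pws_lreg_low _ _ 1) => [[]|] //; apply: lreg1. Qed.

Lemma pws_sumE (I : Type) (r : seq I) (P : pred I) (F : I -> pws A) n :
  (\sum_(i <- r | P i) F i) n = \sum_(i <- r | P i) F i n.
Proof. by elim/big_ind2: _ => // x y u v <- <-. Qed.

Definition eq_upto N (p q : pws A) := forall n, (n <= N)%N -> p n = q n.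

Lemma eq_uptoM N p q p' q' :
  eq_upto N p p' -> eq_upto N q q' -> eq_upto N (p * q) (p' * q').
Proof.
move=> pp' qq' n le_nN; rewrite !pwsME; apply: eq_bigr => i _.
by rewrite pp' ?qq' //; have := ltn_ord i; lia.
Qed.

Lemma eq_upto_prod N (I : Type) (r : seq I) (P : pred I) (F G : I -> pws A) :
  (forall i, eq_upto N (F i) (G i)) ->
  eq_upto N (\prod_(i <- r | P i) F i) (\prod_(i <- r | P i) G i).
Proof.
by move=> FG; elim/big_ind2: _ => // p p' q q' pp' qq'; apply: eq_uptoM.
Qed.

Lemma eq_upto_sum N (I : Type) (r : seq I) (P : pred I) (F G : I -> pws A) :
  (forall i, eq_upto N (F i) (G i)) ->
  eq_upto N (\sum_(i <- r | P i) F i) (\sum_(i <- r | P i) G i).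
Proof. by move=> FG n le_nN; rewrite !pws_sumE; apply: eq_bigr => i _; apply: FG. Qed.
End PX.

Definition pws_map (A B : Type) (g : A -> B) (p : pws A) : pws B := fun n => g (p n).

Section MapPws.
Variables (A B : comNzRingType) (g : {rmorphism A -> B}).
Lemma pws_map_is_zmod_morphism : zmod_morphism (pws_map g).
Proof. by move=> p q; apply: funext => n; apply: rmorphB. Qed.
Lemma pws_map_is_monoid_morphism : monoid_morphism (pws_map g).
Proof.
split=> [|p q]; apply: funext => n.
  by rewrite /pws_map !pws1E rmorph_nat.
rewrite /pws_map !pwsME rmorph_sum; apply: eq_bigr => i _.
by rewrite rmorphM.
Qed.
HB.instance Definition _ :=
  GRing.isZmodMorphism.Build (pws A) (pws B) (pws_map g) pws_map_is_zmod_morphism.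
HB.instance Definition _ :=
  GRing.isMonoidMorphism.Build (pws A) (pws B) (pws_map g) pws_map_is_monoid_morphism.

Lemma pws_map_pscale c p : pws_map g (pscale c p) = pscale (g c) (pws_map g p).
Proof. by apply: funext => n; rewrite /pws_map /pscale rmorphM rmorphXn. Qed.
End MapPws.

Section Evaluation.
Variables (R : comAlgType rat) (A : comNzRingType) (iota : {rmorphism R -> A}).
Variables (k : nat) (c : 'I_k -> A).

Definition line : 'I_k -> pws A := fun j => pwsC (c j) * pwsX A.
Definition ev : {mpoly R[k]} -> pws A := mmap (@pwsC A \o iota) line.

Definition weight_at (w : 'rV[rat]_k) : A := \sum_(j < k) iota (w 0 j)%:A * c j.
Definition at_weight (f : pser R) (w : 'rV[rat]_k) : pws A :=
  pscale (weight_at w) (pws_map iota f).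

HB.instance Definition _ := GRing.RMorphism.on ev.

Lemma evZ a p : ev (a *: p) = pwsC (iota a) * ev p.
Proof. exact: mmapZ. Qed.

(** The image of ['X_[m]] is a multiple of X^(mdeg m); hence truncation by total degree leaves the
    coefficients up to that degree unchanged. *)
Lemma ev_monomial m n : (n < mdeg m)%N -> ev 'X_[m] n = 0.
Proof.
move=> lt_n; rewrite /ev mmapX /mmap1; under eq_bigr do rewrite exprMn.
rewrite big_split /= prodrXr -mdegE; under eq_bigr do rewrite -rmorphXn.
by rewrite -rmorph_prod pwsCME pwsXnE ltn_eqF // mulr0.
Qed.

Lemma ev_mtrunc N p : eq_upto N (ev (mtrunc N p)) (ev p).
Proof.
move=> n le_nN; rewrite [in RHS](mpolyE p) (bigID (fun m => mdeg m <= N)%N) /=.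
rewrite rmorphD pwsDE -[LHS]addr0; congr (_ + _).
rewrite rmorph_sum pws_sumE big1_seq // => m /andP[]; rewrite -ltnNge => lt_m _.
by rewrite /= evZ pwsCME ev_monomial ?mulr0 //; lia.
Qed.

Lemma ev_linform w : ev (linform R w) = pwsC (weight_at w) * pwsX A.
Proof.
rewrite /linform rmorph_sum /weight_at rmorph_sum mulr_suml.
apply: eq_bigr => j _; rewrite /= evZ /ev mmapX mmap1U rmorphM /=.
by rewrite -mulrA.
Qed.

Lemma ev_comp_lin f w N : eq_upto N (ev (comp_lin f w N)) (at_weight f w).
Proof.
move=> n le_nN; rewrite /comp_lin rmorph_sum pws_sumE.
have lt_nN : (n < N.+1)%N by [].
rewrite (bigD1 (Ordinal lt_nN)) //= big1 ?addr0 => [|i ne_in].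
  rewrite evZ rmorphXn /= ev_linform exprMn -rmorphXn /=.
  by rewrite !pwsCME pwsXnE eqxx mulr1.
rewrite evZ rmorphXn /= ev_linform exprMn -rmorphXn /= !pwsCME pwsXnE.
suff -> : (n == i) = false by rewrite !mulr0.
by apply/negbTE; rewrite eq_sym.
Qed.

Lemma ev_strunc_const N c0 : eq_upto N (ev (strunc N (mpconst c0))) (pwsC (iota c0)).
Proof.
have -> : strunc N (mpconst c0) = c0 *: (1 : {mpoly R[k]}).
  rewrite /strunc (bigD1 bm0) //= big1 ?addr0 => [|m ne_m0].
    by rewrite /mpconst eqxx mpolyX0.
  by rewrite /mpconst ifN ?scale0r.
by rewrite evZ rmorph1 mulr1.
Qed.

(** One summand of the localization formula on the line, kept as a pair (numerator, denominator). *)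
Definition fixterm (f : pser R) (p : rat * seq 'rV[rat]_k) : pws A * pws A :=
  (pwsC (iota p.1%:A), \prod_(w <- p.2) at_weight f w).

Lemma equiv_genus_line f M c0 : equiv_genus_is f M (mpconst c0) ->
  \sum_(p < size M) (fixterm f (nth (0, [::]) M p)).1 *
      \prod_(q < size M | q != p) (fixterm f (nth (0, [::]) M q)).2
  = pwsC (iota c0) * \prod_(p <- M) (fixterm f p).2.
Proof.
(* The coefficient of X^N is already determined by the truncation in degree N. *)
move=> gen; apply: funext => N.
have := ev_mtrunc (strunc N (mpconst c0) * \prod_(p <- M) \prod_(w <- p.2) comp_lin f w N).
move/(_ N N (leqnn N)); rewrite -gen ev_mtrunc // rmorphM /= => eqN.
transitivity ((ev (strunc N (mpconst c0)) *
    ev (\prod_(p <- M) \prod_(w <- p.2) comp_lin f w N)) N); last first.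
  apply: (@eq_uptoM _ N) => //; first exact: ev_strunc_const.
  rewrite rmorph_prod; apply: eq_upto_prod => p /=.
  by rewrite rmorph_prod; apply: eq_upto_prod => w; apply: ev_comp_lin.
rewrite -eqN rmorph_sum.
apply: (@eq_upto_sum _ N) => // p n le_nN /=; symmetry; move: n le_nN.
rewrite evZ; apply: eq_uptoM => //.
rewrite rmorph_prod; apply: eq_upto_prod => q /=.
by rewrite rmorph_prod; apply: eq_upto_prod => w; apply: ev_comp_lin.
Qed.
End Evaluation.

(** * Sums of formal fractions *)

Section Fractions.
Variable B : comNzRingType.
Implicit Types x y : B * B.
(* Addition of formal fractions (numerator, denominator); it makes the cleared
   localization sum independent of the order of the fixed points. *)
Definition fadd x y : B * B := (x.1 * y.2 + y.1 * x.2, x.2 * y.2).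
Lemma faddA : associative fadd.
Proof. by move=> x y z; congr pair => /=; ring. Qed.
Lemma faddC : commutative fadd.
Proof. by move=> x y; congr pair => /=; ring. Qed.
Lemma fadd0 : left_id (0, 1) fadd.
Proof. by move=> [x y]; congr pair => /=; ring. Qed.
HB.instance Definition _ :=
  Monoid.isComLaw.Build (B * B)%type (0, 1) fadd faddA faddC fadd0.

Lemma fadd_big2 (I : Type) (M : seq I) (F : I -> B * B) :
  (\big[fadd/(0, 1)]_(p <- M) F p).2 = \prod_(p <- M) (F p).2.
Proof. by elim: M => [|p M IH]; rewrite ?big_nil // !big_cons /= IH. Qed.

Lemma fadd_big1 (I : Type) (M : seq I) (i0 : I) (F : I -> B * B) :
  (\big[fadd/(0, 1)]_(p <- M) F p).1 =
  \sum_(p < size M) (F (nth i0 M p)).1 *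
     \prod_(q < size M | q != p) (F (nth i0 M q)).2.
Proof.
elim: M => [|x M IH]; first by rewrite big_nil big_ord0.
rewrite big_cons big_ord_recl /= IH fadd_big2; congr (_ * _ + _).
  rewrite [RHS]big_mkcond big_ord_recl /= mul1r (big_nth i0) big_mkord.
  by apply: eq_bigr.
rewrite mulr_suml; apply: eq_bigr => p _ /=.
rewrite -mulrA; congr (_ * _); rewrite [in RHS]big_mkcond big_ord_recl /= mulrC.
by congr (_ * _); rewrite [in LHS]big_mkcond.
Qed.
End Fractions.

Lemma equiv_genus_frac (R : comAlgType rat) (A : comNzRingType)
    (iota : {rmorphism R -> A}) (k : nat) (c : 'I_k -> A) f (M : fixdata k) c0 :
  equiv_genus_is f M (mpconst c0) ->
  let T := \big[@fadd (pws A)/(0, 1)]_(p <- M) fixterm iota c f p in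
  T.1 = pwsC (iota c0) * T.2.
Proof.
move=> gen /=; rewrite (fadd_big1 _ (0, [::])) fadd_big2.
exact: equiv_genus_line.
Qed.

(** * The sphere S^6 *)

Section RatAlgebra.
Variable R : comAlgType rat.

Lemma mulrn_eq0_rat (x : R) n : (0 < n)%N -> x *+ n = 0 -> x = 0.
Proof.
move=> n_gt0 /eqP; rewrite -scaler_nat scaler_eq0 pnatr_eq0 -leqn0 leqNgt n_gt0.
by move/eqP.
Qed.

Lemma pexpM (a : R) i j : pexp a i * pexp a j = pexp a (i + j)%N *+ 'C(i + j, i).
Proof.
rewrite /pexp -scalerAl -scalerAr scalerA -exprD scalerMnl; congr (_ *: _).
have fn0 m : (m`!%:R : rat) != 0 by rewrite pnatr_eq0 -lt0n fact_gt0.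
have := @bin_fact (i + j) i (leq_addr _ _); rewrite addKn => <-.
rewrite -mulr_natr !natrM; field.
by rewrite !fn0 pnatr_eq0 -lt0n bin_gt0 leq_addr.
Qed.

Lemma pexp_scaleM (a c d : R) :
  pscale c (pexp a) * pscale d (pexp a) = pscale (c + d) (pexp a).
Proof. by apply: pscale_exp => i j; apply: pexpM. Qed.

Lemma pexpE0 (a : R) : pexp a 0%N = 1.
Proof. by rewrite /pexp expr0 invr1 scale1r. Qed.
Lemma pexpE1 (a : R) : pexp a 1%N = a.
Proof. by rewrite /pexp expr1 invr1 scale1r. Qed.

Lemma pscale0_pexp (a : R) : pscale 0 (pexp a) = 1.
Proof.
apply: funext => n; rewrite /pscale pws1E.
by case: n => [|n]; rewrite ?pexpE0 ?mulr1 // expr0n mulr0.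
Qed.

Lemma S6_relation (f : pws R) :
  rigid f S6_fixdata -> genus_value_is f S6_fixdata 0 ->
  pscale (-1) f ^+ 2 * pscale 2%:R f + f ^+ 2 * pscale (- 2%:R) f = 0.
Proof.
(* The genus value, tested on the constant series provided by rigidity, shows that this constant is
   0. *)
move=> [c gen] val; have c0 := val _ gen; rewrite /mpconst eqxx in c0.
have /= := @equiv_genus_frac R R idfun 2 (fun=> 1) f _ _ gen.
rewrite /S6_fixdata !big_cons big_nil /fixterm /= !big_cons !big_nil /at_weight.
have w (w0 : 'rV[rat]_2) : weight_at idfun (fun=> 1) w0 = (w0 0 0 + w0 0 1)%:A :> R.
  rewrite /weight_at big_ord_recl big_ord1 !mulr1 /= scalerDl.
  by congr (_%:A + (w0 _ _)%:A); apply: val_inj.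
rewrite !w !mxE /= c0 rmorph0 !scale1r rmorph1.
have -> : pws_map idfun f = f by [].
rewrite pscale1 !(subr0, oppr0, sub0r, addr0, add0r) -opprD.
rewrite -[1 + 1]/(2%:R) !scaleNr scaler_nat scale1r.
by rewrite !mul0r => <-; ring.
Qed.
End RatAlgebra.

Section Odd.
Variable R : comAlgType rat.
(** In terms of even and odd parts the relation is e(2x) (e^2 + o^2) = 2 e o o(2x). If e starts in
    degree n, the coefficient of degree n + 2 gives 4 (2^n - 4) e_n = 0. Degree 2 is the degenerate
    case, excluded by [h 2 = 0]. *)
Lemma odd_of_relation (h : pws R) :
  h 0%N = 0 -> h 1%N = 1 -> h 2%N = 0 ->
  pscale (-1) h ^+ 2 * pscale 2%:R h + h ^+ 2 * pscale (- 2%:R) h = 0 ->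
  pscale (-1) h = - h.
Proof.
move=> h0 h1 h2 rel.
(* [e] and [o] are twice the even and the odd part of h. *)
pose e := h + pscale (-1) h; pose o := h - pscale (-1) h.
pose e2 := pscale 2%:R h + pscale (- 2%:R) h.
pose o2 := pscale 2%:R h - pscale (- 2%:R) h.
have eqE : e2 * (e ^+ 2 + o ^+ 2) = 2%:R * e * (o * o2).
  apply/eqP; rewrite -subr_eq0; apply/eqP.
  transitivity (4%:R * (pscale (-1) h ^+ 2 * pscale 2%:R h + h ^+ 2 * pscale (- 2%:R) h)).
    by rewrite /e2 /e /o /o2; ring.
  by rewrite rel mulr0.
have e2E n : e2 n = e n * 2%:R ^+ n.
  by rewrite /e2 /e !pwsDE /pscale [(- _) ^+ n]exprNn; ring.
have e0 n : (n < 3)%N -> e n = 0.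
  by case: n => [|[|[|]]] // _; rewrite /e pwsDE /pscale ?h0 ?h1 ?h2; ring.
have o_low n : (n < 1)%N -> o n = 0.
  by case: n => // _; rewrite /o /o2 pwsDE pwsNE /pscale h0; ring.
have o2_low n : (n < 1)%N -> o2 n = 0.
  by case: n => // _; rewrite /o /o2 pwsDE pwsNE /pscale h0; ring.
suff e_eq0 : e = 0 by apply/eqP; rewrite -addr_eq0 addrC; apply/eqP.
apply: funext; elim/ltn_ind => n IH.
have [/e0 //|n_ge3] := ltnP n 3.
have := congr1 (fun p : pws R => p (n + 2)%N) eqE.
have e_low i : (i < 1)%N -> e i = 0 by move=> lt_i; apply: e0; lia.
have sq_low i : (i < 2)%N -> (e ^+ 2 + o ^+ 2) i = 0.
  by move=> lt_i; rewrite pwsDE !expr2 !(@pwsM_vanish _ _ _ 1 1) ?addr0.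
have oo2_low i : (i < 2)%N -> (o * o2) i = 0.
  by move=> lt_i; rewrite (@pwsM_vanish _ _ _ 1 1).
have e2_low i : (i < n)%N -> e2 i = 0 by move=> lt_i; rewrite e2E IH // mul0r.
rewrite (pwsM_low e2_low sq_low) -mulrA mulr_natl pwsMnE (pwsM_low IH oo2_low).
rewrite pwsDE !expr2 !(@pwsM_low _ _ _ 1 1) //.
rewrite e2E (e0 1%N) // /o2 /o !pwsDE !pwsNE /pscale h1 => eqn.
apply: (@mulrn_eq0_rat _ _ (4 * (2 ^ n - 4))).
  by rewrite muln_gt0 subn_gt0 /= -[4%N]/(2 ^ 2)%N ltn_exp2l.
rewrite -mulr_natr natrM natrB ?natrX; last by rewrite -[4%N]/(2 ^ 2)%N leq_exp2l //; lia.
by move/eqP: eqn; rewrite -subr_eq0 => /eqP <-; ring.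
Qed.
End Odd.

(** * From the addition formula to the differential equation *)

Section PolyCoef.
Variable A : comNzRingType.

Lemma coef_expr_1DX (c : A) n k : ((1 + c *: 'X) ^+ n)`_k = c ^+ k *+ 'C(n, k).
Proof.
rewrite exprDn coef_sum.
under eq_bigr do rewrite expr1n mul1r exprZn coefMn coefZ coefXn.
have [le_kn|lt_nk] := leqP k n.
  have lt_kn : (k < n.+1)%N by [].
  rewrite (bigD1 (Ordinal lt_kn)) //= eqxx mulr1 big1 ?addr0 // => i.
  rewrite -val_eqE eq_sym => /negbTE /= ne_ki.
  by rewrite ne_ki mulr0 mul0rn.
rewrite bin_small // mulr0n big1 // => i _.
by rewrite gtn_eqF ?mulr0 ?mul0rn //; have := ltn_ord i; lia.
Qed.

(* The series s(yX), where y is itself a polynomial in a parameter. *)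
Definition spoly (s : pws A) (y : {poly A}) : pws {poly A} :=
  pscale y (pws_map polyC s).

(** The divided derivative X^k s^(k) / k!, that is, the Taylor coefficient of s(X + tX) at t^k. *)
Definition pbin k (s : pws A) : pws A := fun n => s n *+ 'C(n, k).

Lemma pcoef_spoly1DX s c k :
  pcoef k (spoly s (1 + c *: 'X)) = pwsC (c ^+ k) * pbin k s.
Proof.
apply: funext => n; rewrite pwsCME /pcoef /spoly /pscale /pws_map /= coefCM.
by rewrite coef_expr_1DX /pbin !mulrnAr mulrC.
Qed.

Lemma pcoef_spolyX s c k :
  pcoef k (spoly s (c *: 'X)) = pwsC (s k * c ^+ k) * pwsX A ^+ k.
Proof.
apply: funext => n; rewrite pwsCME /pcoef /spoly /pscale /pws_map /= coefCM.
rewrite exprZn coefZ coefXn pwsXnE eq_sym.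
by case: eqP => [->|_]; rewrite ?mulr0 ?mulr1.
Qed.

Lemma pbin0 s : pbin 0 s = s.
Proof. by apply: funext => n; rewrite /pbin bin0. Qed.
End PolyCoef.

Section Derivation.
Variable R : comAlgType rat.
Implicit Types p q s : pws R.

Lemma pbin1 s : pbin 1 s = pwsX R * pderiv s.
Proof.
apply: funext => n; rewrite /pbin bin1.
by case: n => [|n]; rewrite ?pwsXM0 ?pwsXMS ?mulr0n.
Qed.
Lemma pbin2 s : pbin 2 s *+ 2 = pwsX R ^+ 2 * pderiv (pderiv s).
Proof.
apply: funext => n; rewrite pwsMnE /pbin expr2 -mulrA.
case: n => [|[|n]]; rewrite ?pwsXM0 ?pwsXMS ?pwsXM0 ?mulr0n ?mul0rn //.
rewrite /pderiv -!mulrnA; congr (_ *+ _).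
by rewrite -[X in (_ * X)%N]/(2`!) bin_ffact ffactnS ffactn1 mulnC.
Qed.

(** The operator X d/dX multiplies the n-th coefficient by n, which makes Leibniz immediate; X is
    then cancelled. *)
Lemma pderivM p q : pderiv (p * q) = (pderiv p : pws R) * q + p * (pderiv q : pws R).
Proof.
apply: (@pwsX_lreg R); rewrite mulrDr mulrA [_ * (p * _)]mulrCA -!pbin1.
apply: funext => n; rewrite pwsDE /pbin !pwsME -big_split -sumrMnl /=.
apply: eq_bigr => -[i /= lt_in] _; by rewrite !bin1 mulrnAl mulrnAr -mulrnDr subnKC.
Qed.

Lemma pderivB p q : pderiv (p - q) = (pderiv p : pws R) - (pderiv q : pws R).
Proof. by apply: funext => n; rewrite /pderiv !pwsDE !pwsNE mulrnBl. Qed.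

Lemma pderivCM (c : R) p : pderiv (pwsC c * p) = pwsC c * (pderiv p : pws R).
Proof. by apply: funext => n; rewrite pwsCME /pderiv pwsCME mulrnAr. Qed.

Lemma pderiv_C (c : R) : pderiv (pwsC c) = 0 :> pws R.
Proof. by apply: funext => n; rewrite /pderiv mul0rn. Qed.

(* The solutions d of s d' = 4 s' d are the multiples of s^4. *)
Lemma euler_eq0 (s d : pws R) : s 0%N = 0 -> s 1%N = 1 -> d 0%N = 0 -> d 4%N = 0 ->
  s * (pderiv d : pws R) = 4%:R * (pderiv s : pws R) * d -> d = 0.
Proof.
move=> s0 s1 d0 d4 eqd; apply: funext; elim/ltn_ind => -[_ //|n] IH.
(* With the lower coefficients zero, this one reads (n + 1) d_(n+1) = 4 d_(n+1). *)
have := congr1 (fun p : pws R => p (1 + n)%N) eqd.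
rewrite (@pwsM_low _ _ _ 1 n) => [|[]//|i lt_in]; last first.
  by rewrite /pderiv IH ?mul0rn.
have low_sd : ((pderiv s : pws R) * d) (0 + (1 + n))%N = pderiv s 0 * d (1 + n)%N.
  by apply: pwsM_low => // i /IH.
rewrite -mulrA mulr_natl pwsMnE -[(1 + n)%N in RHS]add0n low_sd.
rewrite /pderiv s1 !mul1r add1n => eqn.
have [->//|/eqP ne_n4] := eqVneq n.+1 4%N.
have [lt4|le4] := ltnP 4 n.+1.
  apply: (@mulrn_eq0_rat _ _ (n.+1 - 4)); first by rewrite subn_gt0.
  by rewrite mulrnBr ?eqn ?subrr // ltnW.
apply: (@mulrn_eq0_rat _ _ (4 - n.+1)); first by lia.
by rewrite mulrnBr // eqn subrr.
Qed.

Lemma is_sn_of_addition (s : pws R) : s 0%N = 0 -> s 1%N = 1 -> s 2%N = 0 ->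
  let S := spoly s in
  S 'X * S 1 * (S (1 - 'X) + S (1 + 'X))
    = S (2%:R * 'X) * (S (1 + 'X) * S (1 - 'X) + S 'X ^+ 2) ->
  exists eps, is_sn (- 3%:R * s 3%N) eps s.
Proof.
move=> s0 s1 s2 /= eqS.
pose X := pwsX R; pose D : pws R := pderiv s; pose D2 : pws R := pderiv D.
have ode : s * D2 = 2%:R * D ^+ 2 - 2%:R - 6%:R * pwsC (s 3%N) * s ^+ 2.
  have := congr1 (pcoef 3) eqS.
  (* All arguments are brought to the form 1 + c z or c z, whose coefficients in z are known. *)
  have -> : 1 - 'X = 1 + (-1) *: 'X :> {poly R} by rewrite scaleN1r.
  have -> : 1 + 'X = 1 + 1 *: 'X :> {poly R} by rewrite scale1r.
  have -> : 2%:R * 'X = 2%:R *: 'X :> {poly R} by rewrite scaler_nat mulr_natl.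
  have -> : spoly s 'X = spoly s (1 *: 'X) by rewrite scale1r.
  have -> : spoly s 1 = spoly s (1 + 0 *: 'X) by rewrite scale0r addr0.
  rewrite expr2 !(pcoefM, pcoefD, big_ord_recl, big_ord0).
  rewrite /= /bump /= !(pcoef_spoly1DX, pcoef_spolyX) /= s0 s1 s2.
  rewrite !addn0 !add1n !(rmorphM, rmorphXn, rmorphN, rmorph1, rmorph0) /=.
  rewrite pbin0 pbin1 -[pwsX R]/X -[pderiv s]/D.
  have := pbin2 s; rewrite -[pwsX R]/X -[pderiv s]/D -[pderiv D]/D2.
  move: (pbin 2 s) (pbin 3 s) (pwsC (s 3%N)) => P2 P3 c3 eqP2 eqN.
  (* In the coefficient of z^3 the third divided derivative cancels; with P1 = X s' and 2 P2 = X^2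
     s'' what remains is X^3 times the differential equation. *)
  apply: (@lregX _ _ 3 (@pwsX_lreg R)); rewrite -[pwsX R]/X.
  move/eqP: eqN; rewrite -subr_eq0 => /eqP eqN.
  move/esym/eqP: eqP2; rewrite -subr_eq0 => /eqP eqP2.
  apply/eqP; rewrite -subr_eq0; apply/eqP.
  transitivity (X * s * (X ^+ 2 * D2 - 2%:R * P2)); last first.
    by rewrite mulr_natl eqP2 mulr0.
  rewrite -[RHS]subr0 -[in RHS]eqN; ring.
(* The equation gives s y' = 4 s' y, and s^4 satisfies the same; so y - y_4 s^4 vanishes by
   [euler_eq0]. *)
pose y : pws R := D ^+ 2 - 1 - 6%:R * pwsC (s 3%N) * s ^+ 2.
exists (y 4%N).
have y_sn : y = pwsC (y 4%N) * s ^+ 4.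
  apply/eqP; rewrite -subr_eq0; apply/eqP; apply: (euler_eq0 s0 s1).
  - rewrite pwsDE pwsNE pwsCME [s ^+ 4]exprS pwsM0 s0 mul0r mulr0 subr0.
    rewrite /y !pwsDE !pwsNE pws1E !expr2 -mulrA mulr_natl pwsMnE pwsCME !pwsM0 s0.
    by rewrite /D /pderiv s1 mul0r mulr0 mul0rn subr0 mulr1 subrr.
  - rewrite pwsDE pwsNE pwsCME -[4%N in X in _ - _ * X]/(2 + 2)%N.
    have -> : s ^+ 4 = s ^+ 2 * s ^+ 2 by rewrite -exprD.
    have s_low i : (i < 1)%N -> s i = 0 by case: i.
    have s2_low i : (i < 2)%N -> (s ^+ 2) i = 0.
      by move=> lt_i; rewrite expr2 (@pwsM_vanish _ _ _ 1 1).
    by rewrite (pwsM_low s2_low s2_low) expr2 (@pwsM_low _ _ _ 1 1) // s1; ring.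
  have yE : y = D * D - pwsC 1 - pwsC (6%:R * s 3%N) * (s * s).
    by rewrite rmorphM rmorph_nat rmorph1 /y; ring.
  have s4E : s ^+ 4 = (s * s) * (s * s) by ring.
  rewrite pderivB pderivCM; move: (pwsC (y 4%N)) => c4.
  rewrite s4E yE !pderivB pderiv_C pderivCM !pderivM.
  rewrite -[pderiv s]/D -[pderiv D]/D2.
  have -> : pwsC (6%:R * s 3%N) = 6%:R * pwsC (s 3%N) by rewrite rmorphM rmorph_nat.
  move: (pwsC (s 3%N)) ode => c3 ode.
  transitivity (2%:R * D * (s * D2) - 12%:R * c3 * s ^+ 2 * D - 4%:R * c4 * s ^+ 4 * D).
    by ring.
  by rewrite ode; ring.
split=> // n.
transitivity ((D ^+ 2) n); first by rewrite expr2.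
have -> : D ^+ 2 = 1 + 6%:R * pwsC (s 3%N) * s ^+ 2 + pwsC (y 4%N) * s ^+ 4.
  by rewrite -y_sn /y; ring.
rewrite !pwsDE pwsCME -mulrA mulr_natl pwsMnE pwsCME.
have -> : (1 : pws R) n = pconst 1 n by [].
have -> : (s ^+ 2) n = pmul s s n by rewrite expr2.
have -> : (s ^+ 4) n = pmul (pmul s s) (pmul s s) n.
  by have -> : s ^+ 4 = (s * s) * (s * s) by ring.
by ring.
Qed.
End Derivation.

(** * Fixed points of the quasitoric manifold *)

Section Computable.
Variable F : comNzRingType.
Implicit Types f g : nat -> nat -> F.

Definition lsum n (h : nat -> F) := foldr (fun j a => h j + a) 0 (iota 0 n).
Lemma lsumE n (h : nat -> F) : \sum_(i < n) h i = lsum n h.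
Proof. by rewrite -(big_mkord xpredT h) unlock /index_iota subn0. Qed.

(** Laplace expansion along the first row, on functions of natural numbers so that it evaluates. *)
Fixpoint ldet n f : F :=
  if n is m.+1
  then lsum n (fun j => f 0%N j * ((-1) ^+ j * ldet m (fun a b => f a.+1 (bump j b))))
  else 1.

Lemma ldetS n f : ldet n.+1 f =
  lsum n.+1 (fun j => f 0%N j * ((-1) ^+ j * ldet n (fun a b => f a.+1 (bump j b)))).
Proof. by []. Qed.

Lemma ldetE n f : \det (\matrix_(i < n, j < n) f i j) = ldet n f.
Proof.
elim: n f => [|n IH] f; first by rewrite det_mx00.
rewrite (expand_det_row _ ord0) ldetS -lsumE; apply: eq_bigr => j _.
rewrite mxE /cofactor add0n -IH; congr (_ * (_ * \det _)).
by apply/matrixP => a b; rewrite !mxE.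
Qed.

Lemma lmulmx1 n f g :
  all (fun i => all (fun j => lsum n (fun l => f i l * g l j) == (i == j)%:R)
    (iota 0 n)) (iota 0 n) ->
  (\matrix_(i < n, j < n) f i j) *m (\matrix_(i < n, j < n) g i j) = 1%:M.
Proof.
move/allP=> chk; apply/matrixP => i j; rewrite !mxE.
under eq_bigr do rewrite !mxE.
rewrite (lsumE _ (fun l => f i l * g l j)).
have /chk/allP/(_ (val j)) : (i : nat) \in iota 0 n by rewrite mem_iota ltn_ord.
by rewrite mem_iota ltn_ord => /(_ isT)/eqP.
Qed.
End Computable.

(* ((i, j), (sign, rows of Lambda_v^-1)) for the vertex v lying on all facets but
   the i-th and the j-th, facets being numbered from 0. *)
Definition L23_table : seq ((nat * nat) * (rat * seq (seq rat))) := [::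
  ((0, 3)%N, (1,
    [:: [:: 1; 1; 0; 0; 0]; [:: 1; 0; 0; 0; 0]; [:: -1; 0; 1; 1; 0]; [:: 1; 0; -1; 0; 1]; [:: -1; 0; 1; 0; 0]]));
  ((0, 4)%N, (-1,
    [:: [:: 1; 1; 0; 0; 0]; [:: 1; 0; 0; 0; 0]; [:: -1; 0; 1; 1; 0]; [:: 0; 0; 0; 1; 1]; [:: 0; 0; 0; -1; 0]]));
  ((0, 5)%N, (1,
    [:: [:: 1; 1; 0; 0; 0]; [:: 1; 0; 0; 0; 0]; [:: -1; 0; 1; 0; -1]; [:: 0; 0; 0; 1; 1]; [:: 0; 0; 0; 0; 1]]));
  ((0, 6)%N, (-1,
    [:: [:: 1; 1; 0; 0; 0]; [:: 1; 0; 0; 0; 0]; [:: -1; 0; 1; 0; 0]; [:: 0; 0; 0; 1; 0]; [:: 0; 0; 0; 0; 1]]));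
  ((1, 3)%N, (-1,
    [:: [:: 1; 1; 0; 0; 0]; [:: 0; -1; 0; 0; 0]; [:: 0; 1; 1; 1; 0]; [:: 0; -1; -1; 0; 1]; [:: 0; 1; 1; 0; 0]]));
  ((1, 4)%N, (1,
    [:: [:: 1; 1; 0; 0; 0]; [:: 0; -1; 0; 0; 0]; [:: 0; 1; 1; 1; 0]; [:: 0; 0; 0; 1; 1]; [:: 0; 0; 0; -1; 0]]));
  ((1, 5)%N, (-1,
    [:: [:: 1; 1; 0; 0; 0]; [:: 0; -1; 0; 0; 0]; [:: 0; 1; 1; 0; -1]; [:: 0; 0; 0; 1; 1]; [:: 0; 0; 0; 0; 1]]));
  ((1, 6)%N, (1,
    [:: [:: 1; 1; 0; 0; 0]; [:: 0; -1; 0; 0; 0]; [:: 0; 1; 1; 0; 0]; [:: 0; 0; 0; 1; 0]; [:: 0; 0; 0; 0; 1]]));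
  ((2, 3)%N, (-1,
    [:: [:: 1; 0; 0; 0; 0]; [:: 0; 1; 0; 0; 0]; [:: 0; 0; 1; 1; 0]; [:: 0; 0; -1; 0; 1]; [:: 0; 0; 1; 0; 0]]));
  ((2, 4)%N, (1,
    [:: [:: 1; 0; 0; 0; 0]; [:: 0; 1; 0; 0; 0]; [:: 0; 0; 1; 1; 0]; [:: 0; 0; 0; 1; 1]; [:: 0; 0; 0; -1; 0]]));
  ((2, 5)%N, (-1,
    [:: [:: 1; 0; 0; 0; 0]; [:: 0; 1; 0; 0; 0]; [:: 0; 0; 1; 0; -1]; [:: 0; 0; 0; 1; 1]; [:: 0; 0; 0; 0; 1]]));
  ((2, 6)%N, (1,
    [:: [:: 1; 0; 0; 0; 0]; [:: 0; 1; 0; 0; 0]; [:: 0; 0; 1; 0; 0]; [:: 0; 0; 0; 1; 0]; [:: 0; 0; 0; 0; 1]]))].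

Definition L23_Atab : seq (seq rat) :=
  [:: [:: 1; 0; 0; 0; 0]; [:: 0; 1; 0; 0; 0]; [:: -1; -1; 0; 0; 0];
      [:: 0; 0; 1; 0; 0]; [:: 0; 0; 0; 1; 0]; [:: 0; 0; 0; 0; 1];
      [:: 0; 0; -1; -1; -1]].
Definition L23_Ltab : seq (seq int) :=
  [:: [:: 1; 0; 1; 0; 0; 0; 0]; [:: 0; 1; -1; 0; 0; 0; 0];
      [:: 0; 0; 1; 1; 0; 0; 1]; [:: 0; 0; 0; 0; 1; 0; -1];
      [:: 0; 0; 0; 0; 0; 1; 1]].

(** A vertex of P lies on five of the seven facets and is encoded by the two it misses; the filter
    keeps the increasing order used in [A_v] and [Lam_v]. *)
Definition cofacets (i j : nat) : seq nat :=
  [seq k <- iota 0 7 | (k != i) && (k != j)].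
Definition Acof i j : nat -> nat -> rat :=
  fun r l => nth 0 (nth [::] L23_Atab (nth 0%N (cofacets i j) r)) l.
Definition bfun (r : nat) : rat := nth 0 [:: 0; 0; 1; 0; 0; 0; 1] r.
Definition bcof i j : nat -> rat := fun r => bfun (nth 0%N (cofacets i j) r).
Definition Lcof i j : nat -> nat -> rat :=
  fun r l => (nth 0 (nth [::] L23_Ltab r) (nth 0%N (cofacets i j) l))%:~R.

(* Leaving the facet 2 or 6 gives the origin of the corresponding simplex. *)
Definition vertex_coord (i j l : nat) : rat :=
  (((l == i) && (i < 2)) || (l.+1 == j))%N%:R.

(** A certificate: inverses and vertex points are verified by multiplication instead of being
    computed. *)
Definition L23_check (e : (nat * nat) * (rat * seq (seq rat))) : bool :=
  let: ((i, j), (s, B)) := e in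
  [&& (i < 3)%N, (3 <= j)%N, (j < 7)%N, size B == 5%N,
      Num.sg (ldet 5 (Lcof i j) * ldet 5 (Acof i j)) == s,
      ldet 5 (Acof i j) != 0,
      all (fun a => all (fun c =>
        lsum 5 (fun l => (nth 0 (nth [::] B a) l) * Lcof i j l c) == (a == c)%:R)
          (iota 0 5)) (iota 0 5),
      all (fun a => lsum 5 (fun l => Acof i j a l * vertex_coord i j l) + bcof i j a == 0)
        (iota 0 5) &
      all (fun a => 0 <= lsum 5 (fun l => nth 0 (nth [::] L23_Atab a) l
                                  * vertex_coord i j l) + bfun a)
        (iota 0 7)].

Lemma L23_table_ok : all L23_check L23_table.
Proof. by vm_compute. Qed.

(** If both omitted facets belong to the same simplex, all facets of the other simplex remain, and
    their normals add up to 0. *)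
Lemma Acof_singular :
  all (fun i => all (fun j =>
     (ldet 5 (Acof i j) != 0) ==> ((i, j) \in map fst L23_table)
           || ((j, i) \in map fst L23_table) || (i == j))
     (iota 0 7)) (iota 0 7).
Proof. by vm_compute. Qed.

Definition cofacet_set (x y : 'I_7) : {set 'I_7} := ~: [set x; y].

Lemma facet_cofacet n (x y : 'I_7) (l : 'I_n) :
  facet_of (cofacet_set x y) l = nth 0%N (cofacets x y) l :> nat.
Proof.
have -> : cofacets x y = map val (enum (cofacet_set x y)).
  rewrite /cofacets -val_enum_ord filter_map {2}/enum_mem -enumT; congr map.
  by apply: eq_filter => z /=; rewrite !inE negb_or.
rewrite /facet_of; set s := enum _.
have [lt_l|le_l] := ltnP l (size s); first by rewrite (nth_map ord0).
by rewrite !nth_default ?size_map.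
Qed.

Lemma A_v_cofacet x y :
  A_v L23_A (cofacet_set x y) = \matrix_(r < 5, l < 5) Acof x y r l.
Proof. by apply/matrixP => r l; rewrite !mxE facet_cofacet. Qed.
Lemma Lam_v_cofacet x y :
  Lam_v L23_Lam (cofacet_set x y) = \matrix_(r < 5, l < 5) Lcof x y r l.
Proof. by apply/matrixP => r l; rewrite !mxE facet_cofacet. Qed.
Lemma b_v_cofacet x y :
  b_v 5 L23_b (cofacet_set x y) = \col_(r < 5) bcof x y r.
Proof. by apply/colP => r; rewrite !mxE facet_cofacet. Qed.

Definition rowl (s : seq rat) : 'rV[rat]_5 := \row_j s`_j.

Lemma cofacet_setP (S : {set 'I_7}) :
  is_vertex L23_A L23_b S ->
  S \in [seq cofacet_set (inord e.1.1) (inord e.1.2) | e <- L23_table].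
Proof.
case/and3P=> cardS; rewrite unitmxE unitfE => detS _.
have /cards2P[x [y [ne_xy eqS]]] : #|~: S| == 2%N.
  by rewrite cardsCs setCK (eqP cardS) card_ord.
have {eqS} eqS : S = cofacet_set x y by rewrite /cofacet_set -eqS setCK.
move: detS; rewrite eqS A_v_cofacet ldetE => detS.
have /allP/(_ (val x)) := Acof_singular; rewrite mem_iota ltn_ord => /(_ isT).
move/allP/(_ (val y)); rewrite mem_iota ltn_ord => /(_ isT) /implyP/(_ detS).
have sym : cofacet_set x y = cofacet_set y x by rewrite /cofacet_set setUC.
rewrite -[(val x == val y)]/(x == y) (negbTE ne_xy) orbF.
case/orP=> /mapP[e e_in eq_e]; apply/mapP; exists e => //.
  by rewrite -eq_e /= !inord_val.
by rewrite -eq_e /= !inord_val.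
Qed.

Lemma L23_checkP e : L23_check e ->
  let V := cofacet_set (inord e.1.1) (inord e.1.2) in
  is_vertex L23_A L23_b V /\
  (qt_sign L23_A L23_Lam V, qt_weights L23_Lam V) = (e.2.1, map rowl e.2.2).
Proof.
case: e => [[i j] [s B]] /and5P[lt_i3 le_3j lt_j7 /eqP sizeB].
case/and5P=> /eqP sgE detA /lmulmx1 BL /allP Av /allP vertex_ge0 V.
have xE : (inord i : 'I_7) = i :> nat by rewrite inordK //; lia.
have yE : (inord j : 'I_7) = j :> nat by rewrite inordK.
have eqA := A_v_cofacet (inord i) (inord j); have eqL := Lam_v_cofacet (inord i) (inord j).
have eqb := b_v_cofacet (inord i) (inord j).
rewrite !xE !yE -/V in eqA eqL eqb.
have unitA : A_v L23_A V \in unitmx by rewrite unitmxE unitfE eqA ldetE.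
have pointE : vertex_point L23_A L23_b V = \col_(l < 5) vertex_coord i j l.
  (* The vertex is identified by A_v x = - b_v. *)
  rewrite /vertex_point; apply: (canLR (@opprK _)).
  apply: (canLR (mulKmx unitA)); rewrite mulmxN; apply/eqP.
  rewrite -addr_eq0 addrC; apply/eqP/colP => a; rewrite eqA eqb !mxE.
  under eq_bigr do rewrite !mxE.
  rewrite (lsumE _ (fun l => Acof i j a l * vertex_coord i j l)).
  by apply/eqP/Av; rewrite mem_iota ltn_ord.
split.
  rewrite /is_vertex unitA pointE cardsCs setCK card_ord cards2.
  have -> : (inord i : 'I_7) != inord j by rewrite -val_eqE /= xE yE; lia.
  apply/forallP => a; rewrite !mxE; under eq_bigr do rewrite !mxE.
  rewrite (lsumE _ (fun l => nth 0 (nth [::] L23_Atab a) l * vertex_coord i j l)).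
  by apply: vertex_ge0; rewrite mem_iota ltn_ord.
congr pair; first by rewrite /qt_sign eqL eqA !ldetE.
rewrite /qt_weights eqL.
have -> : invmx (\matrix_(r < 5, l < 5) Lcof i j r l)
        = \matrix_(r < 5, l < 5) nth 0 (nth [::] B r) l.
  have [_ unitL] := mulmx1_unit BL.
  by rewrite -[LHS]mul1mx -BL mulmxK.
apply: (@eq_from_nth _ 0) => [|r]; rewrite size_map size_enum_ord.
  by rewrite size_map sizeB.
move=> lt_r5.
rewrite (nth_map ord0) ?size_enum_ord // (nth_map [::]) ?sizeB //.
by apply/rowP => l; rewrite !mxE nth_enum_ord.
Qed.

(** A permutation suffices because [fadd] is commutative, so the enumeration order of sets of facets
    never has to be determined. *)
Lemma L23_fixdata_perm :
  perm_eq L23_fixdata [seq (e.2.1, map rowl e.2.2) | e <- L23_table].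
Proof.
pose F (V : {set 'I_7}) := (qt_sign L23_A L23_Lam V, qt_weights L23_Lam V).
pose W (e : (nat * nat) * (rat * seq (seq rat))) := cofacet_set (inord e.1.1) (inord e.1.2).
have chk e : e \in L23_table -> L23_check e by move/(allP L23_table_ok).
have -> : [seq (e.2.1, map rowl e.2.2) | e <- L23_table] = map F (map W L23_table).
  by rewrite -map_comp; apply/eq_in_map => e /chk/L23_checkP[_ <-].
apply/perm_map/uniq_perm; first exact: enum_uniq.
  have -> : map W L23_table
      = [seq cofacet_set (inord k.1) (inord k.2) | k <- map fst L23_table].
    by rewrite -map_comp.
  rewrite map_inj_in_uniq => [|[i1 j1] [i2 j2]]; first by vm_compute.
  (* Since i < 3 <= j, the unordered pair of omitted facets determines (i, j). *)
  have bnd k : k \in map fst L23_table -> (k.1 < 3 <= k.2)%N && (k.2 < 7)%N.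
    by case/mapP=> -[[i j] [? ?]] /chk/and5P[h1 h2 h3 _ _] ->; rewrite /= h1 h2 h3.
  move=> /bnd/andP[/andP[/= lt1 le1] lt1'] /bnd/andP[/andP[/= lt2 le2] lt2'].
  move/setC_inj/setP => eqV.
  have inordE m n : (m < 7)%N -> (n < 7)%N -> (inord m == inord n :> 'I_7) = (m == n).
    by move=> lt_m lt_n; rewrite -val_eqE /= !inordK.
  have := eqV (inord i1); have := eqV (inord j1).
  by rewrite !inE !inordE ?eqxx ?orbT; try lia; move=> h1 h2; congr pair; lia.
move=> V; rewrite mem_enum inE; apply/idP/idP; first exact: cofacet_setP.
by case/mapP=> e /chk/L23_checkP[vV _] ->.
Qed.

(** * Rigidity of the quasitoric manifold *)

(** A common factor t of the n denominators changes the numerator by t^(n-1); the extra t on the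
    left keeps the formula valid for n = 0. *)
Lemma fadd_scale (B : comNzRingType) (t : B) (I : Type) (M : seq I) (n d : I -> B) :
  let T := \big[@fadd B/(0, 1)]_(p <- M) (n p, t * d p) in
  let T' := \big[@fadd B/(0, 1)]_(p <- M) (n p, d p) in
  t * T.1 = t ^+ size M * T'.1 /\ T.2 = t ^+ size M * T'.2.
Proof.
elim: M => [|p M /= [IH1 IH2]] /=; first by rewrite !big_nil /= !mulr0 mulr1.
rewrite !big_cons /= IH2; split; last by rewrite exprS; ring.
by rewrite mulrDr [t * (_.1 * _)]mulrA IH1 exprS; ring.
Qed.

Lemma lreg_scale_cancel (B : comNzRingType) (t c x y x' y' : B) n :
  GRing.lreg t -> t * x = t ^+ n * x' -> y = t ^+ n * y' -> x = c * y ->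
  x' = t * c * y'.
Proof.
move=> regt ex ey exy; apply: (@lregX _ _ n regt).
by rewrite -ex exy ey; ring.
Qed.

Section Line.
Variable R : comAlgType rat.
Implicit Types (s f : pws R) (ab : rat * rat).

Definition lin ab : {poly R} := (ab.1%:A)%:P + ab.2%:A *: 'X.

Lemma lreg_rat (a : rat) : a != 0 -> GRing.lreg (a%:A : R).
Proof.
move=> a0; apply: mulrI0_lreg => x; rewrite -scalerAl mul1r => /eqP.
by rewrite scaler_eq0 (negbTE a0) => /eqP.
Qed.

(** The leading coefficient is a nonzero rational, hence regular in any rational algebra. *)
Lemma lin_lreg ab : ab != (0, 0) -> GRing.lreg (lin ab).
Proof.
case: ab => a b; rewrite xpair_eqE negb_and /lin /=.
have [->|b0 _] := eqVneq b 0.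
  rewrite orbF scale0r scale0r addr0 => a0; apply: lreg_lead.
  by rewrite lead_coefC; apply: lreg_rat.
have regb := lreg_rat b0; apply: lreg_lead; rewrite lead_coefDr.
  by rewrite lead_coef_lreg // lead_coefX mulr1.
by rewrite lreg_size // size_polyX ltnS size_polyC leq_b1.
Qed.

Lemma spoly_lreg s y : s 0%N = 0 -> s 1%N = 1 -> GRing.lreg y -> GRing.lreg (spoly s y).
Proof.
move=> s0 s1 regy; apply: (@pws_lreg_low _ _ 1) => [[]|] //.
  by move=> _; rewrite /spoly /pscale /pws_map s0 mul0r.
by rewrite /spoly /pscale /pws_map s1 mul1r.
Qed.

Lemma weight_at_lin (pt : seq (rat * rat)) (l : seq rat) :
  weight_at (@polyC R) (fun j : 'I_5 => lin (nth (0, 0) pt j)) (rowl l)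
  = lin (lsum 5 (fun j => l`_j * (nth (0, 0) pt j).1),
         lsum 5 (fun j => l`_j * (nth (0, 0) pt j).2)).
Proof.
rewrite /weight_at /lin /= -!(lsumE _ (fun j => l`_j * _)) !scaler_suml rmorph_sum /=.
rewrite -big_split /=; apply: eq_bigr => j _; rewrite !mxE mulrDr.
rewrite -polyCM -scalerAl mul1r scalerA; congr (_ + _).
by rewrite mul_polyC scalerA -scalerAl mul1r scalerA.
Qed.

Lemma spolyN s y : pscale (-1) s = - s -> spoly s (- y) = - spoly s y.
Proof.
move=> odd_s; rewrite /spoly.
have -> : - y = (-1)%:P * y by rewrite polyCN mulN1r.
by rewrite -pscale_pscale -pws_map_pscale odd_s !rmorphN.
Qed.

Lemma spolyM s s' y : spoly (s * s') y = spoly s y * spoly s' y.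
Proof. by rewrite /spoly !rmorphM. Qed.

Lemma spoly_pexp a y z : spoly (pexp a) y * spoly (pexp a) z
  = spoly (pexp a) (y + z) :> pws {poly R}.
Proof.
apply: pscale_exp => i j; rewrite /pws_map -rmorphM -rmorphMn.
by congr (_ _); apply: pexpM.
Qed.

Lemma spoly_pexp0 a : spoly (pexp a) 0 = 1 :> pws {poly R}.
Proof.
apply: funext => n; rewrite /spoly /pscale pws1E /pws_map.
by case: n => [|n]; rewrite ?pexpE0 ?mulr1 // expr0n mulr0.
Qed.

Lemma spoly_pexp_prod a (I : Type) (r : seq I) (y : I -> {poly R}) :
  \prod_(i <- r) spoly (pexp a) (y i) = spoly (pexp a) (\sum_(i <- r) y i) :> pws {poly R}.
Proof.
elim: r => [|i r IH]; first by rewrite !big_nil spoly_pexp0.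
by rewrite !big_cons IH spoly_pexp.
Qed.

(** Values of weights stay pairs of rationals, independent of [R], so that the table evaluates. *)
Definition eval_table (pt : seq (rat * rat)) :=
  [seq (e.2.1, [seq (lsum 5 (fun j => l`_j * (nth (0, 0) pt j).1),
                     lsum 5 (fun j => l`_j * (nth (0, 0) pt j).2)) | l : seq rat <- e.2.2])
   | e <- L23_table].

Definition term_at s (p : rat * seq (rat * rat)) : pws {poly R} * pws {poly R} :=
  (pwsC (p.1%:A)%:P, \prod_(w <- p.2) spoly s (lin w)).

(* Weights at each vertex add up to x1 + ... + x5 (the manifold is SU), so the factors
   e^(alpha w) of f(w) contribute the same unit at every vertex. *)
Lemma L23_relation s (a : R) f : f = (pexp a : pws R) * s -> rigid f L23_fixdata ->
  exists c0 : R, forall pt : seq (rat * rat),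
  let T := \big[@fadd (pws {poly R})/(0, 1)]_(p <- eval_table pt) term_at s p in
  T.1 = spoly (pexp a) (\sum_(j < 5) lin (nth (0, 0) pt j)) * pwsC c0%:P * T.2.
Proof.
(* The constant is fixed before the point, so its vanishing at one point can be used at another. *)
move=> fE [c0 gen]; exists c0 => {}pt /=.
set E := spoly _ _.
have := equiv_genus_frac (@polyC R) (fun j : 'I_5 => lin (nth (0, 0) pt j)) gen.
rewrite /= (perm_big _ L23_fixdata_perm) big_map.
have -> : \big[@fadd (pws {poly R})/(0, 1)]_(e <- L23_table)
    fixterm (@polyC R) (fun j : 'I_5 => lin (nth (0, 0) pt j)) f (e.2.1, map rowl e.2.2)
  = \big[@fadd (pws {poly R})/(0, 1)]_(p <- eval_table pt)
      (pwsC (p.1%:A)%:P, E * \prod_(w <- p.2) spoly s (lin w)).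
  rewrite big_map; apply: eq_big_seq => e e_in; rewrite /fixterm /=; congr pair.
  rewrite !big_map /E.
  transitivity (\prod_(l <- e.2.2) (spoly (pexp a) (weight_at (@polyC R)
        (fun j : 'I_5 => lin (nth (0, 0) pt j)) (rowl l))
      * spoly s (weight_at (@polyC R) (fun j : 'I_5 => lin (nth (0, 0) pt j)) (rowl l)))).
    by apply: eq_bigr => l _; rewrite -spolyM -fE.
  rewrite big_split /= spoly_pexp_prod; congr (spoly _ _ * _); last first.
    by apply: eq_bigr => l _; rewrite weight_at_lin.
  rewrite /weight_at exchange_big /=; apply: eq_bigr => j _.
  rewrite -mulr_suml -rmorph_sum /= -scaler_suml.
  under eq_bigr do rewrite mxE.
  have /allP/(_ e e_in)/allP/(_ (val j)) : all (fun e : (nat * nat) * (rat * seq (seq rat)) =>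
     all (fun k => foldr (fun l a => l`_k + a) 0 e.2.2 == 1) (iota 0 5)) L23_table
    by vm_compute.
  rewrite mem_iota ltn_ord => /(_ isT)/eqP sum1.
  have -> : \sum_(l <- e.2.2) l`_j = 1 by rewrite unlock -[RHS]sum1.
  by rewrite scale1r mul1r.
have [T1 T2] := fadd_scale E (eval_table pt) (fun p => pwsC (p.1%:A)%:P)
  (fun p => \prod_(w <- p.2) spoly s (lin w)).
move=> eqT; have regE : GRing.lreg E.
  by apply: pws_lreg0; rewrite /E /spoly /pscale /pws_map pexpE0 mulr1.
exact: lreg_scale_cancel regE T1 T2 eqT.
Qed.

(* The points (x1, .., x5) = (u, v, z, a, b) at which rigidity is used, a pair (p, q)
   encoding p + q z.  At the first one all three values of Phi vanish by oddness, hence the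
   constant is 0; at the second one only Phi(z) survives. *)
Definition pt_const : seq (rat * rat) := [:: (4, 0); (2, 0); (1, 0); (1, 0); (2, 0)].
Definition pt_line : seq (rat * rat) := [:: (1, 0); (1, -2); (0, 1); (1, 0); (0, -1)].

Definition tab_const : seq (rat * seq (rat * rat)) := [::
      (1, [:: (6, 0); (4, 0); (-2, 0); (5, 0); (-3, 0)]);
      (-1, [:: (6, 0); (4, 0); (-2, 0); (3, 0); (-1, 0)]);
      (1, [:: (6, 0); (4, 0); (-5, 0); (3, 0); (2, 0)]);
      (-1, [:: (6, 0); (4, 0); (-3, 0); (1, 0); (2, 0)]);
      (-1, [:: (6, 0); (-2, 0); (4, 0); (-1, 0); (3, 0)]);
      (1, [:: (6, 0); (-2, 0); (4, 0); (3, 0); (-1, 0)]);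
      (-1, [:: (6, 0); (-2, 0); (1, 0); (3, 0); (2, 0)]);
      (1, [:: (6, 0); (-2, 0); (3, 0); (1, 0); (2, 0)]);
      (-1, [:: (4, 0); (2, 0); (2, 0); (1, 0); (1, 0)]);
      (1, [:: (4, 0); (2, 0); (2, 0); (3, 0); (-1, 0)]);
      (-1, [:: (4, 0); (2, 0); (-1, 0); (3, 0); (2, 0)]);
      (1, [:: (4, 0); (2, 0); (1, 0); (1, 0); (2, 0)])].
Definition tab_line : seq (rat * seq (rat * rat)) := [::
      (1, [:: (2, -2); (1, 0); (0, 1); (1, -2); (-1, 1)]);
      (-1, [:: (2, -2); (1, 0); (0, 1); (1, -1); (-1, 0)]);
      (1, [:: (2, -2); (1, 0); (-1, 2); (1, -1); (0, -1)]);
      (-1, [:: (2, -2); (1, 0); (-1, 1); (1, 0); (0, -1)]);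
      (-1, [:: (2, -2); (-1, 2); (2, -1); (-1, 0); (1, -1)]);
      (1, [:: (2, -2); (-1, 2); (2, -1); (1, -1); (-1, 0)]);
      (-1, [:: (2, -2); (-1, 2); (1, 0); (1, -1); (0, -1)]);
      (1, [:: (2, -2); (-1, 2); (1, -1); (1, 0); (0, -1)]);
      (-1, [:: (1, 0); (1, -2); (1, 1); (0, -2); (0, 1)]);
      (1, [:: (1, 0); (1, -2); (1, 1); (1, -1); (-1, 0)]);
      (-1, [:: (1, 0); (1, -2); (0, 2); (1, -1); (0, -1)]);
      (1, [:: (1, 0); (1, -2); (0, 1); (1, 0); (0, -1)])].
Lemma eval_const : eval_table pt_const = tab_const.
Proof. by apply/eqP; vm_compute. Qed.
Lemma eval_line : eval_table pt_line = tab_line.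
Proof. by apply/eqP; vm_compute. Qed.

Section OddSeries.
Variable s : pws R.
Hypothesis (s0 : s 0%N = 0) (s1 : s 1%N = 1) (odd_s : pscale (-1) s = - s).
Let g (x y : rat) := spoly s (lin (x, y)).

Lemma spoly_lin_opp x y x' y' : x' = - x -> y' = - y -> g x' y' = - g x y.
Proof.
move=> -> ->; rewrite /g -spolyN //; congr (spoly _ _).
by rewrite /lin /= !scaleNr polyCN opprD.
Qed.

Lemma spoly_lin_lreg x y : (x, y) != (0, 0) -> GRing.lreg (g x y).
Proof. by move=> ne0; apply: spoly_lreg => //; apply: lin_lreg. Qed.

(** Here t = (0, z, -a, b) consists of -1, 0, 1, 2; replacing z by z+v or z-u gives -1, 0, 2, 3 and
    -3, -1, 0, 2. All three are symmetric, so the numerator is 0, while no weight vanishes. *)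
Lemma rigid_const0 (c0 : R) (E : pws {poly R}) : GRing.lreg E ->
  let T := \big[@fadd (pws {poly R})/(0, 1)]_(p <- eval_table pt_const) term_at s p in
  T.1 = E * pwsC c0%:P * T.2 -> c0 = 0.
Proof.
move=> regE /=; rewrite eval_const.
have regT : GRing.lreg (\big[@fadd (pws {poly R})/(0, 1)]_(p <- tab_const) term_at s p).2.
  rewrite fadd_big2; apply: ssrcomplements.lreg_prod => p p_in _.
  apply: ssrcomplements.lreg_prod => -[x y] w_in _; apply: spoly_lin_lreg.
  have nz : all (fun p : rat * seq (rat * rat) => all (fun w => w != (0, 0)) p.2) tab_const.
    by vm_compute.
  exact: (allP (allP nz p p_in) _ w_in).
have -> : (\big[@fadd (pws {poly R})/(0, 1)]_(p <- tab_const) term_at s p).1 = 0.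
  rewrite /tab_const !big_cons big_nil /= /term_at /= !big_cons !big_nil -!/(g _ _).
  rewrite (@spoly_lin_opp 1 0 (-1) 0) // (@spoly_lin_opp 2 0 (-2) 0) // (@spoly_lin_opp 3 0 (-3) 0) //.
  rewrite (@spoly_lin_opp 5 0 (-5) 0) // scaleN1r scale1r polyCN rmorphN !rmorph1.
  ring.
move=> eq0; have : pwsC c0%:P = 0 :> pws {poly R}.
  by apply: regT; apply: regE; rewrite mulr0 mulr0 [_.2 * _]mulrC mulrA.
by move/(congr1 (fun p : pws {poly R} => p 0%N)) => /= /eqP; rewrite polyC_eq0 => /eqP.
Qed.

Lemma line_addition :
  (\big[@fadd (pws {poly R})/(0, 1)]_(p <- eval_table pt_line) term_at s p).1 = 0 ->
  g 0 1 * g 1 0 * (g 1 (-1) + g 1 1)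
    = g 0 2 * (g 1 1 * g 1 (-1) + g 0 1 ^+ 2).
Proof.
rewrite eval_line => T0; apply/eqP; rewrite -subr_eq0; apply/eqP.
(* The cofactor of the addition formula in the cleared numerator; none of its linear forms is zero,
   so it can be cancelled. *)
pose K := g 0 1 ^+ 8 * g 0 2 * g 1 (-2) ^+ 9 * g 1 (-1) ^+ 9 * g 1 0 ^+ 14 * g 1 1
  * g 2 (-2) ^+ 8 * g 2 (-1) ^+ 2.
have regK : GRing.lreg K.
  by rewrite /K; repeat apply: lregM; try apply: lregX; apply: spoly_lin_lreg.
apply: regK; rewrite mulr0 -[RHS]T0.
rewrite /tab_line !big_cons big_nil /= /term_at /= !big_cons !big_nil -!/(g _ _).
rewrite (@spoly_lin_opp 1 0 (-1) 0) // (@spoly_lin_opp 1 (-1) (-1) 1) // (@spoly_lin_opp 1 (-2) (-1) 2) //.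
rewrite (@spoly_lin_opp 0 1 0 (-1)) // (@spoly_lin_opp 0 2 0 (-2)) // scaleN1r scale1r polyCN rmorphN !rmorph1.
by rewrite /K; ring.
Qed.
End OddSeries.
End Line.

Theorem theorem2p2 (R : comAlgType rat) (f : pser R) :
  f 0%N = 0 -> f 1%N = 1 ->
  rigid f S6_fixdata ->
  genus_value_is f S6_fixdata 0 ->
  rigid f L23_fixdata ->
  exists (alpha delta eps : R) (sn : pser R),
    is_sn delta eps sn /\ f = pmul (pexp alpha) sn.
Proof.
(* The choice alpha = f_2 makes the quadratic coefficient of e^(-alpha x) f vanish. *)
move=> f0 f1 rigS6 valS6 rigL; pose a := f 2%N.
pose e : pws R := pexp a; pose s : pws R := pscale (-1) e * f.
have scale_e c d : pscale c e * pscale d e = pscale (c + d) e by apply: pexp_scaleM.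
have fE : f = e * s.
  by rewrite /s mulrA -{1}[e]pscale1 scale_e subrr pscale0_pexp mul1r.
have s0 : s 0%N = 0 by rewrite /s pwsM0 f0 mulr0.
have s1 : s 1%N = 1.
  by rewrite /s pwsME !big_ord_recl big_ord0 /= f0 f1 /pscale /e pexpE0; ring.
have s2 : s 2%N = 0.
  rewrite /s pwsME !big_ord_recl big_ord0 /= f0 f1 /pscale /e pexpE0 pexpE1.
  by rewrite /a; ring.
have odd_s : pscale (-1) s = - s.
  apply: odd_of_relation => //.
  have scale_s c : pscale c s = pscale (- c) e * pscale c f.
    by rewrite /s rmorphM /= pscale_pscale mulN1r.
  have sE : s = pscale (-1) e * pscale 1 f by rewrite pscale1.
  have eq0 : pscale 0 e = 1 by apply: pscale0_pexp.
  (* The three weights at each fixed point of S^6 add up to 0, so the exponentials drop out of the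
     relation. *)
  have eP : pscale 1 e ^+ 2 * pscale (- 2%:R) e = 1.
    by rewrite expr2 !scale_e -eq0; congr (pscale _ _); ring.
  have eN : pscale (-1) e ^+ 2 * pscale 2%:R e = 1.
    by rewrite expr2 !scale_e -eq0; congr (pscale _ _); ring.
  rewrite !scale_s {1}sE pscale1 !opprK.
  rewrite -[RHS](S6_relation rigS6 valS6) -[LHS]addr0.
  transitivity ((pscale 1 e ^+ 2 * pscale (- 2%:R) e) * (pscale (-1) f ^+ 2 * pscale 2%:R f)
    + (pscale (-1) e ^+ 2 * pscale 2%:R e) * ((f : pws R) ^+ 2 * pscale (- 2%:R) f)); first by ring.
  by rewrite eP eN !mul1r.
have [c0 relL] := L23_relation fE rigL.
have regE y : GRing.lreg (spoly (pexp a) y : pws {poly R}).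
  by apply: pws_lreg0; rewrite /spoly /pscale /pws_map pexpE0 mulr1.
have c0_eq0 := rigid_const0 s0 s1 odd_s (@regE _) (relL pt_const).
have := relL pt_line; cbv zeta; rewrite c0_eq0 polyC0 rmorph0 mulr0 mul0r.
move/(line_addition s0 s1 odd_s) => add_s.
have [eps sn_s] : exists eps, is_sn (- 3%:R * s 3%N) eps s.
  apply: is_sn_of_addition => //=.
  have linE x y : lin R (x, y) = x%:A%:P + y%:A *: 'X by [].
  move: add_s; rewrite !linE !scale0r !polyC0 !add0r !scale1r !addr0 scaleN1r scaleN1r.
  by rewrite scaler_nat !polyC1 scaler_nat mulr_natl.
by exists a, (- 3%:R * s 3%N), eps, s.
Qed.
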